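(* For every sequence $(a_n)_{n\ge1}$ of non-negative real numbers, $$\sum_{n=1}^{\infty}\left(\frac1n\sum_{k=n}^\infty a_k\right)^{1/2}\ge 0.8967\sum_{n=1}^\infty a_n^{1/2}.$$
   Context: Sums of non-negative terms are understood as elements of $[0,\infty]$; if $\sum_k a_k$ diverges, the left-hand side is $+\infty$ and the inequality is trivially true. *)

(* Defs.v *)
From mathcomp Require Import all_boot all_order all_algebra.
From mathcomp Require Import all_classical all_reals all_analysis.

(* Main.v *)
Require Import Defs.
From mathcomp Require Import all_boot all_order all_algebra.
From mathcomp Require Import all_classical all_reals all_analysis.
From mathcomp Require Import ring lra.
Import Order.TTheory GRing.Theory Num.Theory.
Import numFieldNormedType.Exports.

(** Write [s_n] for the tail sum [\sum_(k >= n) a_k], so [a_n = s_n - s_(n+1)],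
    and let [c = 0.8967]. By Cauchy-Schwarz,
    [c sqrt a_n + w_(n+1) sqrt s_(n+1) <= w_n sqrt s_n + sqrt (s_n / n)]
    as soon as [c^2 + w_(n+1)^2 <= (w_n + 1 / sqrt n)^2]. Telescoping such
    inequalities with [w_1 = 0] and [w_n >= 0] gives the result. The condition
    holds for [w_n = (14/25 n - 1/2) / sqrt n] for [n >= 2]: it reads, for
    [n >= 2], [2 b - b^2 >= c^2] with [b = 14/25], up to a positive term in
    [1/n], and for [n = 1] it is [1 - c^2 >= (2 b - 1/2)^2 / 2]. *)

Local Open Scope ring_scope.

(** At 1 the linear formula would give 3/50; the value 0 lets the telescoping start without a
    boundary term. *)
Definition weight_num (R : realType) (n : nat) : R :=
  if (n <= 1)%N then 0 else 14 / 25 * n%:R - 1 / 2.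

Definition weight (R : realType) (n : nat) : R :=
  weight_num R n / Num.sqrt n%:R.

Lemma weight1 (R : realType) : weight R 1 = 0.
Proof. by rewrite /weight /weight_num mul0r. Qed.

Lemma weight_ge0 (R : realType) (n : nat) : 0 <= weight R n.
Proof.
rewrite divr_ge0 ?sqrtr_ge0// /weight_num; case: leqP => // n_gt1.
have : 2 <= n%:R :> R by rewrite ler_nat.
lra.
Qed.

(* The bound on [c ^+ 2] is [2 b - b ^+ 2] for [b = 14 / 25]. *)
Lemma weight_step (R : realType) (c : R) (n : nat) :
  c ^+ 2 <= 504 / 625 -> (1 <= n)%N ->
  c ^+ 2 + weight R n.+1 ^+ 2
    <= (weight R n + (Num.sqrt n%:R)^-1) ^+ 2.
Proof.
move=> c_le n_ge1; rewrite -[X in weight R n + X]mul1r -mulrDl !exprMn !exprVn.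
rewrite !sqr_sqrtr ?ler0n// /weight_num ltnNge n_ge1/=.
case: leqP => [n_le1|n_gt1].
  have -> : n = 1%N by apply/eqP; rewrite eqn_leq n_le1 n_ge1.
  lra.
have x_ge2 : 2 <= n%:R :> R by rewrite ler_nat.
rewrite -(natr1 n); move: (n%:R) x_ge2 => x x_ge2.
rewrite -subr_ge0.
(* The shift 1/2 makes the constant terms of the bases opposite, +1/2 against [x] and -1/2 against
   [x + 1], so the reciprocal terms differ by 1/4 of [1 / x - 1 / (x + 1)], which is positive. *)
have -> : (14 / 25 * x - 1 / 2 + 1) ^+ 2 / x
    - (c ^+ 2 + (14 / 25 * (x + 1) - 1 / 2) ^+ 2 / (x + 1))
  = (504 / 625 - c ^+ 2) + 1 / 4 / (x * (x + 1)) :> R.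
  by field; apply/andP; split; apply/eqP; lra.
by apply: addr_ge0; [lra | rewrite !divr_ge0 ?mulr_ge0//; lra].
Qed.

(** Cauchy-Schwarz for [(c, u)] and the vector of the two roots, whose norm is [Num.sqrt s]. *)
Lemma sqrt_step (R : realType) (c u v s t : R) :
  0 <= v -> 0 <= t -> t <= s -> c ^+ 2 + u ^+ 2 <= v ^+ 2 ->
  c * Num.sqrt (s - t) + u * Num.sqrt t <= v * Num.sqrt s.
Proof.
move=> v_ge0 t_ge0 t_le_s cuv.
have s_ge0 : 0 <= s by exact: le_trans t_le_s.
(* The signs of [c] and [u] are free, so squaring needs a positive left side. *)
have [lhs_le0|lhs_gt0] := leP (c * Num.sqrt (s - t) + u * Num.sqrt t) 0.
  by apply: le_trans lhs_le0 _; rewrite mulr_ge0 ?sqrtr_ge0.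
rewrite -ler_sqr ?nnegrE ?mulr_ge0 ?sqrtr_ge0 ?(ltW lhs_gt0)//.
rewrite [leRHS]exprMn sqr_sqrtr//.
have hp : Num.sqrt (s - t) ^+ 2 = s - t by rewrite sqr_sqrtr// subr_ge0.
have hq : Num.sqrt t ^+ 2 = t by rewrite sqr_sqrtr.
move: (Num.sqrt (s - t)) (Num.sqrt t) hp hq => p q hp hq {lhs_gt0}.
apply: (@le_trans _ _ ((c ^+ 2 + u ^+ 2) * s)); last exact: ler_wpM2r.
have -> : s = p ^+ 2 + q ^+ 2 by rewrite hp hq subrK.
rewrite -subr_ge0.
(* Lagrange's identity. *)
have -> : (c ^+ 2 + u ^+ 2) * (p ^+ 2 + q ^+ 2) - (c * p + u * q) ^+ 2
  = (c * q - u * p) ^+ 2 by ring.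
exact: sqr_ge0.
Qed.

Lemma partial_sum_le (R : realType) (c : R) (a s : nat -> R) :
  c ^+ 2 <= 504 / 625 ->
  (forall n, (1 <= n)%N -> 0 <= a n) -> (forall n, (1 <= n)%N -> 0 <= s n) ->
  (forall n, (1 <= n)%N -> s n = a n + s n.+1) -> forall n,
  c * \sum_(1 <= k < n.+1) Num.sqrt (a k)
      + weight R n.+1 * Num.sqrt (s n.+1)
    <= \sum_(1 <= k < n.+1) Num.sqrt (1 / k%:R * s k).
Proof.
move=> c_le a_ge0 s_ge0 sE; elim=> [|n IHn].
  by rewrite !big_geq// weight1 mulr0 mul0r addr0.
rewrite !(@big_nat_recr _ _ _ n.+1 1)//= mulrDr.
have aE : a n.+1 = s n.+1 - s n.+2 by rewrite (sE n.+1)// addrK.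
have := @sqrt_step R c (weight R n.+2)
  (weight R n.+1 + (Num.sqrt n.+1%:R)^-1) (s n.+1) (s n.+2).
rewrite addr_ge0 ?weight_ge0 ?invr_ge0 ?sqrtr_ge0// s_ge0// weight_step//.
rewrite -subr_ge0 -aE a_ge0// => /(_ isT isT isT isT).
rewrite mulrDl div1r [Num.sqrt (_^-1 * _)]sqrtrM ?invr_ge0 ?ler0n//.
rewrite sqrtrV ?ler0n//.
lra.
Qed.

Local Open Scope ereal_scope.

Lemma nneseries_recl_from (R : realType) (a : nat -> \bar R) (n : nat) :
  (forall k, (n <= k)%N -> 0 <= a k) ->
  \sum_(n <= k <oo) a k = a n + \sum_(n.+1 <= k <oo) a k.
Proof. by move=> a_ge0; rewrite (nneseries_split n 1)// addn1 big_nat1. Qed.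

Theorem theorem1p4 (R : realType) (a : nat -> R)
  (a_ge0 : forall n : nat, (1 <= n)%N -> (0 <= a n)%R) :
  \sum_(1 <= n <oo) sqrte ((1 / n%:R)%R%:E * \sum_(n <= k <oo) (a k)%:E)
  >= (8967 / 10000)%R%:E * \sum_(1 <= n <oo) sqrte (a n)%:E.
Proof.
pose S n := \sum_(n <= k <oo) (a k)%:E.
have S_ge0 n : (1 <= n)%N -> 0 <= S n.
  move=> n1; apply: nneseries_ge0 => k nk _.
  by rewrite lee_fin a_ge0// (leq_trans n1).
have SE n : (1 <= n)%N -> S n = (a n)%:E + S n.+1.
  move=> n1; rewrite /S nneseries_recl_from// => k nk.
  by rewrite lee_fin a_ge0// (leq_trans n1).
have T_ge0 n : (1 <= n)%N -> true -> 0 <= sqrte ((1 / n%:R)%R%:E * S n).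
  by move=> _ _; exact: sqrte_ge0.
(* If the full sum is infinite, so is the first term of the larger series; otherwise all tails are
   real numbers. *)
have [S1oo|S1fin] := eqVneq (S 1%N) +oo.
  have := @nneseries_lim_ge R _ xpredT 1 2 T_ge0.
  by rewrite big_nat1 S1oo divr1 mul1e/= leye_eq => /eqP ->; rewrite leey.
have S_fin n : (1 <= n)%N -> S n \is a fin_num.
  elim: n => // -[_ _|n IHn _]; first by rewrite ge0_fin_numE ?S_ge0// ltey.
  by have := IHn isT; rewrite (SE n.+1)// fin_numD => /andP[].
pose s n := fine (S n).
have Ss n : (1 <= n)%N -> S n = (s n)%:E by move=> n1; rewrite fineK ?S_fin.
have s_ge0 n : (1 <= n)%N -> (0 <= s n)%R by move=> n1; rewrite fine_ge0 ?S_ge0.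
have sE n : (1 <= n)%N -> (s n = a n + s n.+1)%R.
  by move=> n1; apply: EFin_inj; rewrite EFinD -!Ss// SE.
have c_ge0 : (0 <= 8967 / 10000 :> R)%R by lra.
(* Numerically, 0.80407... against 0.8064. *)
have c_le : ((8967 / 10000) ^+ 2 <= 504 / 625 :> R)%R by lra.
move: (8967 / 10000)%R c_ge0 c_le => c c_ge0 c_le.
rewrite -nneseriesZl; last by move=> n _; exact: sqrte_ge0.
apply: lime_le.
  by apply: is_cvg_nneseries => n _ _; rewrite mule_ge0 ?lee_fin ?sqrte_ge0.
apply: nearW => -[|n]; first by rewrite big_geq// nneseries_ge0.
apply: le_trans (@nneseries_lim_ge R _ xpredT 1 n.+1 T_ge0).
rewrite [leRHS](_ : _ = \sum_(1 <= k < n.+1)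
    (Num.sqrt (1 / k%:R * s k))%:E); last first.
  by apply: eq_big_nat => k /andP[k1 _]; rewrite Ss// -EFinM.
rewrite [leLHS](_ : _ = \sum_(1 <= k < n.+1) (c * Num.sqrt (a k))%:E); last first.
  by apply: eq_bigr => k _; rewrite EFinM.
rewrite !sumEFin lee_fin -mulr_sumr.
apply: le_trans (partial_sum_le _ _ _ _ c_le a_ge0 s_ge0 sE n).
by rewrite lerDl mulr_ge0 ?weight_ge0 ?sqrtr_ge0.
Qed.
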